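(* Let $\theta>0$, $\alpha>-1$, and put $\tilde\alpha=\frac{\alpha+1}{\theta}-1$, $\tilde\theta=\frac1\theta$. Then the asymptotic behaviour of the biorthogonal Hermite ensemble in the bulk of the spectrum is invariant under the change of parameters $(\alpha,\theta)\mapsto(\tilde\alpha,\tilde\theta)$ combined with the transformation $x\mapsto\operatorname{sign}(x)\cdot|x|^{\frac1\theta}$ of the phase space $(-\infty,+\infty)$. That is, for every $n\ge1$, the image of the measure $\rho^{Her(\tilde\alpha,\tilde\theta)}_n(x_1,\ldots,x_n)\,dx_1\cdots dx_n$ on $\mathbb R^n$ under the map applying $x\mapsto\operatorname{sign}(x)|x|^{1/\theta}$ to each coordinate is the measure $\rho^{Her(\alpha,\theta)}_n(x_1,\ldots,x_n)\,dx_1\cdots dx_n$.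
   Context: Convention: for real $x$, $x^{\theta}$ means $\operatorname{sign}(x)|x|^{\theta}$, and $x^{\theta k}=(x^\theta)^k$ for integers $k$. For $\theta>0$, $\alpha>-1$, the $N$-point biorthogonal Hermite ensemble on $\mathbb R$ has joint probability density $$p^{Her}_N(x_1,\ldots,x_N)=\mathrm{const}\cdot\prod_{i=1}^N|x_i|^{\alpha}\prod_{1\le i<j\le N}\left[(x_i-x_j)(x_i^{\theta}-x_j^{\theta})\right]e^{-x_1^2-\cdots-x_N^2}$$ (total integral $1$), with correlation functions $\rho^{Her}_{nN}(x_1,\ldots,x_n)=\frac{N!}{(N-n)!}\int_{\mathbb R^{N-n}}p^{Her}_N\,dx_{n+1}\cdots dx_N$. With $M=N/2$, the limit correlation functions in the bulk of the spectrum are (almost everywhere on $\mathbb R^n$) $$\rho_n^{Her(\alpha,\theta)}(x_1,\ldots,x_n)=\lim_{N\to\infty}\frac1{M^{\frac{n}{2\theta}}}\rho^{Her}_{nN}\left(\frac{x_1}{M^{\frac1{2\theta}}},\ldots,\frac{x_n}{M^{\frac1{2\theta}}}\right)=\prod_{i=1}^n|x_i|^{\alpha}\cdot\det\left[\mathcal K^{Her(\alpha,\theta)}(x_i,x_j)\right]_{i,j=1}^n,$$ $$\mathcal K^{Her(\alpha,\theta)}(x,y)=\mathcal K^{\left(\frac{\alpha-1}{2},\theta\right)}(x^2,y^2)+x\,y^{\theta}\cdot\mathcal K^{\left(\frac{\alpha+\theta}{2},\theta\right)}(x^2,y^2),$$ where for $\beta>-1$ and $x,y\ge0$ $$\mathcal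 K^{(\beta,\theta)}(x,y)=\sum_{k,l=0}^{\infty}\frac{(-1)^{k}x^{k}}{k!\,\Gamma\left(\frac{\beta+1+k}{\theta}\right)}\,\frac{(-1)^l y^{\theta l}}{l!\,\Gamma(\beta+1+\theta l)}\,\frac{\theta}{\beta+1+k+\theta l}.$$ *)

(* Defs.v *)
From HB Require Import structures.
From mathcomp Require Import all_boot all_order all_algebra.
From mathcomp Require Import all_classical all_reals all_analysis.

Set Implicit Arguments.
Unset Strict Implicit.
Unset Printing Implicit Defensive.

Import Order.TTheory GRing.Theory Num.Theory.
Import numFieldNormedType.Exports.

Local Open Scope classical_set_scope.
Local Open Scope ring_scope.

(** * Lebesgue measure on R^n

    R^n is [n.-tuple R] with the product sigma-algebra of the Borel sets.
    Its Lebesgue measure is the n-fold product of [lebesgue_measure], built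
    by transporting [lebesgue_measure \x mu] along (x, t) |-> x :: t. *)

Section tuple_measure.
Context {R : realType}.

Definition consT n (p : measurableTypeR R * n.-tuple (measurableTypeR R)) :
  n.+1.-tuple (measurableTypeR R) := [tuple of p.1 :: p.2].

Lemma measurable_consT n : measurable_fun [set: _] (@consT n).
Proof.
exact: (measurable_cons (f := fst) (g := snd) measurable_fst measurable_snd).
Qed.

Lemma measurable_unconsT n : measurable_fun [set: _]
  (fun t : n.+1.-tuple (measurableTypeR R) => (thead t, [tuple of behead t])).
Proof.
apply/measurable_fun_pairP; split => /=.
  exact: measurable_tnth.
exact: measurable_behead.
Qed.

Section step.
Variables (n : nat)
  (mu : {sigma_finite_measure set (n.-tuple (measurableTypeR R)) -> \bar R}).

Definition tuple_step : set (n.+1.-tuple (measurableTypeR R)) -> \bar R :=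
  pushforward ((@lebesgue_measure R) \x mu)%E (@consT n).

Let tuple_step0 : tuple_step set0 = 0%E.
Proof. by rewrite /tuple_step /pushforward preimage_set0 measure0. Qed.

Let tuple_step_ge0 A : (0 <= tuple_step A)%E.
Proof. by rewrite /tuple_step /pushforward; exact: measure_ge0. Qed.

Let tuple_step_sigma_additive : semi_sigma_additive tuple_step.
Proof.
move=> F mF tF mUF; rewrite /tuple_step /pushforward preimage_bigcup.
apply: measure_semi_sigma_additive.
- by move=> k; rewrite -[X in measurable X]setTI; exact: measurable_consT.
- apply/trivIsetP => /= i j _ _ ij; rewrite -preimage_setI.
  by move/trivIsetP : tF => /(_ _ _ _ _ ij) ->//; rewrite preimage_set0.
- by rewrite -preimage_bigcup -[X in measurable X]setTI; exact: measurable_consT.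
Qed.

HB.instance Definition _ := isMeasure.Build _ _ _ tuple_step
  tuple_step0 tuple_step_ge0 tuple_step_sigma_additive.

Let tuple_step_sigma_finite : sigma_finite setT tuple_step.
Proof.
have /sigma_finiteP[F [TF ndF Foo]] := sigma_finiteT (@lebesgue_measure R).
have /sigma_finiteP[G [TG ndG Goo]] := sigma_finiteT mu.
pose unconsT (t : n.+1.-tuple (measurableTypeR R)) :=
  (thead t, [tuple of behead t]).
exists (fun k => unconsT @^-1` (F k `*` G k)).
  apply/seteqP; split => // t _.
  have [i _ Fi] : (\bigcup_i F i) (unconsT t).1 by rewrite -TF.
  have [j _ Gj] : (\bigcup_j G j) (unconsT t).2 by rewrite -TG.
  exists (maxn i j) => //; split.
    by move: Fi; exact/subsetPset/ndF/leq_maxl.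
  by move: Gj; exact/subsetPset/ndG/leq_maxr.
move=> k; have [mF Fk] := Foo k; have [mG Gk] := Goo k; split.
  rewrite -[X in measurable X]setTI; apply: measurable_unconsT => //.
  exact: measurableX.
have unconsTK : unconsT \o @consT n = id.
  apply/funext => -[x t]; rewrite /unconsT /consT /= theadE; congr pair.
  exact: val_inj.
rewrite /tuple_step /pushforward -comp_preimage unconsTK preimage_id.
by rewrite product_measure1E// lte_mul_pinfty// ge0_fin_numE.
Qed.

HB.instance Definition _ :=
  Measure_isSigmaFinite.Build _ _ _ tuple_step tuple_step_sigma_finite.

End step.

Fixpoint lebesgue_tuple n :
    {sigma_finite_measure set (n.-tuple (measurableTypeR R)) -> \bar R} :=
  if n is n'.+1 then tuple_step (lebesgue_tuple n')
  else \d_([tuple] : 0.-tuple (measurableTypeR R)).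

End tuple_measure.

Notation Rn R n := (n.-tuple (measurableTypeR R)).

(** * The biorthogonal Hermite ensemble *)

Section hermite.
Context {R : realType}.

(** The convention x^t = sign(x) |x|^t, also for x < 0. *)
Definition spow (x t : R) : R := Num.sg x * `|x| `^ t.

Definition spow_map n (t : R) (x : Rn R n) : Rn R n :=
  map_tuple (fun u : R => spow u t) x.

Definition her_weight (a t : R) N (x : Rn R N) : R :=
  (\prod_(i < N) `|tnth x i| `^ a) *
  (\prod_(i < N) \prod_(j < N | (i < j)%N)
     ((tnth x i - tnth x j) * (spow (tnth x i) t - spow (tnth x j) t))) *
  expR (- \sum_(i < N) tnth x i ^+ 2).

Definition her_density (a t : R) N (x : Rn R N) : R :=
  her_weight a t x / \int[lebesgue_tuple N]_y her_weight a t y.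

(** The n-point correlation function of the N-point ensemble with N = n + m:
    m = N - n is the number of integrated variables, and N!/(N-n)! is the
    prefactor. *)
Definition her_corr (a t : R) n m (x : Rn R n) : R :=
  (n + m)`!%:R / m`!%:R *
  \int[lebesgue_tuple m]_y her_density a t [tuple of x ++ y].

(** Rescaled correlation function, with M = N/2 = (n + m)/2. *)
Definition her_scaled_corr (a t : R) n m (x : Rn R n) : R :=
  let M : R := (n + m)%:R / 2 in
  (M `^ (n%:R / (2 * t)))^-1 *
  her_corr a t m
    (map_tuple (fun u : R => u / (M `^ (1 / (2 * t)))) x : Rn R n).

Definition Gamma (z : R) : R :=
  \int[lebesgue_measure]_(u in `]0, +oo[%classic) (u `^ (z - 1) * expR (- u)).

(** K^(b,t)(x,y) for x, y >= 0. The double series converges absolutely; its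
    sum is taken along the square partial sums k, l < n. *)
Definition bulk_kernel (b t x y : R) : R :=
  limn (fun n : nat => \sum_(k < n) \sum_(l < n)
    ((-1) ^+ k * x ^+ k / (k`!%:R * Gamma ((b + 1 + k%:R) / t))) *
    ((-1) ^+ l * (y `^ t) ^+ l / (l`!%:R * Gamma (b + 1 + t * l%:R))) *
    (t / (b + 1 + k%:R + t * l%:R))).

Definition her_kernel (a t x y : R) : R :=
  bulk_kernel ((a - 1) / 2) t (x ^+ 2) (y ^+ 2) +
  x * spow y t * bulk_kernel ((a + t) / 2) t (x ^+ 2) (y ^+ 2).

Definition her_det (a t : R) n (x : Rn R n) : R :=
  (\prod_(i < n) `|tnth x i| `^ a) *
  \det (\matrix_(i < n, j < n) her_kernel a t (tnth x i) (tnth x j)).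

(** [rho] is the n-th limit correlation function in the bulk: for almost every
    x in R^n, rho(x) = lim_N (rescaled correlation function)(x)
                     = prod_i |x_i|^a * det K(x_i, x_j).
    As m = N - n, N -> oo amounts to m -> oo. *)
Definition her_bulk_corr (a t : R) n (rho : Rn R n -> measurableTypeR R) :=
  measurable_fun [set: Rn R n] rho /\
  {ae lebesgue_tuple n, forall x,
    (fun m => her_scaled_corr a t m x) @ \oo --> (rho x : R) /\
    rho x = her_det a t x}.

(** The measure rho(x) dx on R^n, as a set function. *)
Definition density_measure n (rho : Rn R n -> measurableTypeR R)
    (A : set (Rn R n)) : \bar R :=
  (\int[lebesgue_tuple n]_(x in A) (rho x : R)%:E)%E.

End hermite.

(* Main.v *)
Require Import Defs.
From mathcomp Require Import all_boot all_order all_algebra.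
From mathcomp Require Import all_classical all_reals all_analysis.
From mathcomp Require Import measurable_realfun ring.
Import Order.TTheory GRing.Theory Num.Theory.
Import numFieldNormedType.Exports.
Local Open Scope classical_set_scope.
Local Open Scope ring_scope.

(** Substitute u = x^theta (the odd power [spow]) in the integral of rho' over
    the preimage of A. In every coordinate du = theta |x|^(theta-1) dx, so the
    claim is that, for almost every x,

      rho'(x_1^theta, ..., x_n^theta) prod_i theta |x_i|^(theta-1) = rho(x).

    Both densities are the determinantal expressions [her_det]. The prefactors
    match because |x^theta|^((alpha+1)/theta-1) |x|^(theta-1) = |x|^alpha when
    x is not 0. The theta^n is absorbed into the determinant, and the kernels
    satisfy the duality [her_kernel_dual]

      theta K~(x^theta, y^theta) = K(y, x),

    so that the two determinants are those of transposed matrices. The duality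
    is an identity between square partial sums of the double series: replacing
    (beta+1, theta) by ((beta+1)/theta, 1/theta) exchanges the two Gamma
    factors, hence the roles of the two summation indices.

    The substitution itself ([ge0_integral_spow_map]) is Tonelli's theorem and
    induction on n over the one-dimensional case [ge0_integral_spow]. There,
    the Jacobian is unbounded near 0 when theta < 1, so the fundamental theorem
    of calculus is used on segments away from 0 only; the rest follows from
    monotone continuity, the symmetry x |-> -x and the uniqueness of the
    Lebesgue measure ([lebesgue_measure_unique_sym]). *)

(** * The odd power function *)

Lemma norm_spow (R : realType) (t x : R) : t != 0 -> `|spow x t| = `|x| `^ t.
Proof.
move=> t0; have [->|x0] := eqVneq x 0.
  by rewrite /spow sgr0 mul0r normr0 powR0.
by rewrite /spow normrM normr_sg x0 mul1r ger0_norm// powR_ge0.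
Qed.

Lemma sgr_spow (R : realType) (t x : R) : Num.sg (spow x t) = Num.sg x.
Proof.
have [->|x0] := eqVneq x 0; first by rewrite /spow sgr0 mul0r sgr0.
by rewrite /spow sgrM sgr_id (gtr0_sg (powR_gt0 _ _)) ?normr_gt0// mulr1.
Qed.

Lemma spowK (R : realType) (t : R) : t != 0 ->
  cancel (fun x : R => spow x t) (fun x => spow x t^-1).
Proof.
move=> t0 x; rewrite {1}/spow sgr_spow norm_spow// -powRrM mulfV// powRr1//.
by rewrite -numEsg.
Qed.

Lemma sqr_spow (R : realType) (t x : R) : t != 0 ->
  spow x t ^+ 2 = (x ^+ 2) `^ t.
Proof.
move=> t0; rewrite -[LHS]real_normK ?num_real// norm_spow//.
rewrite -(real_normK (num_real x)).
by rewrite -(powR_mulrn 2 (powR_ge0 _ _)) -(powR_mulrn 2 (normr_ge0 x))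
  -!powRrM mulrC.
Qed.

Lemma spowN (R : realType) (t x : R) : spow (- x) t = - spow x t.
Proof. by rewrite /spow sgrN normrN mulNr. Qed.

Lemma spow_eq0 (R : realType) (t x : R) : (spow x t == 0) = (x == 0).
Proof. by rewrite -sgr_eq0 sgr_spow sgr_eq0. Qed.

Lemma spow_ge0E (R : realType) (t x : R) : 0 <= x -> t != 0 ->
  spow x t = x `^ t.
Proof.
move=> x0 t0; rewrite /spow ger0_norm//; move: x0; rewrite le_eqVlt.
move=> /predU1P[<-|x0]; first by rewrite sgr0 mul0r powR0.
by rewrite gtr0_sg// mul1r.
Qed.

Lemma ler_spow (R : realType) (t : R) : 0 < t ->
  {mono (fun x : R => spow x t) : x y / x <= y}.
Proof.
move=> t0; have tn0 : t != 0 by rewrite gt_eqF.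
have nneg (x y : R) : 0 <= x -> (spow x t <= spow y t) = (x <= y).
  move=> x0; have [y0|y0] := leP 0 y.
    rewrite !spow_ge0E//; apply/idP/idP => [|xy]; last first.
      by rewrite ge0_ler_powR// ltW.
    by apply: contraTT; rewrite -!ltNge => yx; rewrite gt0_ltr_powR.
  rewrite (spow_ge0E _ _ x)// leNgt [in RHS]leNgt (lt_le_trans y0)//.
  rewrite (@lt_le_trans _ _ 0) ?powR_ge0//.
  by rewrite -sgr_lt0 sgr_spow sgr_lt0.
move=> x y; have [/nneg//|x0] := leP 0 x.
have [y0|y0] := leP 0 y; last first.
  by rewrite -lerN2 -!spowN nneg ?lerN2// oppr_ge0 ltW.
rewrite (le_trans (ltW x0) y0); apply: (@le_trans _ _ 0).
  by rewrite -sgr_le0 sgr_spow sgr_le0 ltW.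
by rewrite -sgr_ge0 sgr_spow sgr_ge0.
Qed.

Lemma measurable_spow (R : realType) (t : R) :
  measurable_fun [set: R] (fun x : R => spow x t).
Proof.
rewrite /spow; apply: measurable_funM; last first.
  by apply: (measurableT_comp (measurable_powR _)); exact: normr_measurable.
rewrite (_ : Num.sg = fun x : R =>
    if x == 0 then 0 else if x < 0 then -1 else 1); last first.
  by apply/funext => x; rewrite sgr_def; case: (x == 0); case: (x < 0).
apply: measurable_fun_ifT.
  exact: measurable_fun_eqr.
  by [].
apply: measurable_fun_ifT => //.
exact: measurable_fun_ltr.
Qed.

(** * Duality of the kernels *)

(** Holds for divergent sequences too: both limits are then the default value
    0. This spares a proof that the kernel series converge. *)
Lemma limn_mulr (R : realType) (c : R) (u : R^nat) : c != 0 ->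
  limn (fun n => u n * c) = limn u * c.
Proof.
move=> c0; have [cu|du] := pselect (cvgn u).
  by apply: cvg_lim => //; exact: cvgMl.
rewrite (dvgP du) dvgP ?mul0r// => cuc; apply: du.
rewrite (_ : u = fun n => u n * c * c^-1); last first.
  by apply/funext => n; rewrite mulfK.
exact: is_cvgMl.
Qed.

(** With b' + 1 = (b + 1) / t one has t (b' + 1 + l) = b + 1 + t l and
    b' + 1 + k / t = (b + 1 + k) / t: each Gamma factor of one series is the
    other Gamma factor of the other series. *)
Lemma bulk_kernel_dual (R : realType) (b t x y : R) : t != 0 ->
    0 <= x -> 0 <= y ->
  bulk_kernel ((b + 1) / t - 1) t^-1 (x `^ t) (y `^ t) * t =
  bulk_kernel b t y x.
Proof.
move=> t0 x0 y0; rewrite /bulk_kernel -limn_mulr//; congr (lim (_ @ \oo)).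
apply/funext => n; rewrite exchange_big/= mulr_suml.
apply: eq_bigr => k _; rewrite mulr_suml; apply: eq_bigr => l _.
rewrite -powRrM mulfV// powRr1//.
have -> : ((b + 1) / t - 1 + 1 + l%:R) / t^-1 = b + 1 + t * l%:R.
  by field.
have -> : (b + 1) / t - 1 + 1 + t^-1 * k%:R = (b + 1 + k%:R) / t by field.
have -> : (b + 1) / t - 1 + 1 + l%:R + t^-1 * k%:R =
  (b + 1 + k%:R + t * l%:R) / t by field.
rewrite invf_div mulKf//.
move: (_ / (_ * _)) (_ / (_ * _)) (b + 1 + _ + _)^-1 => A B Z.
by rewrite (mulrC B) (mulrC t) mulrA.
Qed.

(** Both bulk kernels in [her_kernel] have the shape covered by
    [bulk_kernel_dual], with b = (a - 1) / 2 and b = (a + t) / 2; the factor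
    x y^t turns into x^t (y^t)^(1/t) = x^t y. *)
Lemma her_kernel_dual (R : realType) (a t x y : R) : t != 0 ->
  her_kernel ((a + 1) / t - 1) t^-1 (spow x t) (spow y t) * t =
  her_kernel a t y x.
Proof.
move=> t0; rewrite /her_kernel (spowK _ _ t0) !sqr_spow// mulrDl.
rewrite -!(bulk_kernel_dual _ _ t (x ^+ 2) (y ^+ 2)) ?sqr_ge0//.
have -> : ((a - 1) / 2 + 1) / t - 1 = ((a + 1) / t - 1 - 1) / 2 by field.
have -> : ((a + t) / 2 + 1) / t - 1 = ((a + 1) / t - 1 + t^-1) / 2 by field.
move: (bulk_kernel _ _ _ _) (bulk_kernel _ _ _ _) => K1 K2.
by rewrite (mulrC (spow x t)) !mulrA.
Qed.

(** The coordinates must be nonzero for |x|^(a + 1 - t) |x|^(t - 1) = |x|^a. *)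
Lemma her_det_dual (R : realType) (a t : R) n (x : Rn R n) : t != 0 ->
    (forall i, tnth x i != 0) ->
  her_det ((a + 1) / t - 1) t^-1 (spow_map t x) *
    \prod_(i < n) (t * `|tnth x i| `^ (t - 1)) = her_det a t x.
Proof.
move=> t0 x0; rewrite /her_det big_split/= prodr_const card_ord.
set K' := \matrix_(i, j) _; set K := \matrix_(i, j) _.
have <- : t ^+ n * \det K' = \det K.
  rewrite -detZ -[RHS]det_tr; congr (\det _); apply/matrixP => i j.
  by rewrite !mxE !tnth_map mulrC her_kernel_dual.
have <- : (\prod_(i < n) `|tnth (spow_map t x) i| `^ ((a + 1) / t - 1)) *
    \prod_(i < n) `|tnth x i| `^ (t - 1) = \prod_(i < n) `|tnth x i| `^ a.
  rewrite -big_split/=; apply: eq_bigr => i _.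
  rewrite tnth_map norm_spow// -powRrM -powRD ?normr_eq0 ?x0 ?implybT//.
  by congr (_ `^ _); field.
rewrite -!mulrA; congr (_ * _).
by rewrite mulrCA [X in _ * X = _]mulrC mulrCA.
Qed.

(** * Change of variables on the line *)

(** Only segments that avoid 0 have to be measured: ]c, d] with c = 0 is
    reached as an increasing union, and negative intervals by symmetry. *)
Lemma lebesgue_measure_unique_sym (R : realType)
    (kappa : {measure set (measurableTypeR R) -> \bar R}) :
    (forall A : set R, measurable A -> kappa (-%R @^-1` A) = kappa A) ->
    kappa [set 0] = 0%E ->
    (forall c d : R, 0 < c -> c <= d -> kappa `[c, d]%classic = (d - c)%:E) ->
  forall A : set R, measurable A -> lebesgue_measure A = kappa A.
Proof.
move=> kN k0 kcc.
(* for x > 0 the point x is the degenerate segment [x, x] *)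
have kx (x : R) : 0 <= x -> kappa [set x] = 0%E.
  by rewrite le_eqVlt => /predU1P[<-//|x0]; rewrite -set_itv1 kcc// subrr.
have koc (c d : R) : 0 <= c -> c < d -> kappa `]c, d]%classic = (d - c)%:E.
  move=> c0 cd; rewrite itv_open_bnd_bigcup.
  pose F (n : nat) := `[c + n.+1%:R^-1, d]%classic.
  have : (kappa \o F) n @[n --> \oo] --> kappa (\bigcup_n F n).
    apply: nondecreasing_cvg_mu.
    - by move=> n; exact: measurable_itv.
    - by apply: bigcupT_measurable => n; exact: measurable_itv.
    - move=> m n mn; apply/subsetPset/subset_itvr.
      by rewrite bnd_simp lerD2l lef_pV2 ?posrE// ler_nat.
  move/cvg_lim => <-//; apply/cvg_lim => //.
  have : (d - (c + harmonic n))%:E @[n --> \oo] --> (d - c)%:E.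
    apply: cvg_EFin; first exact: nearW.
    apply: cvgB; first exact: cvg_cst.
    by rewrite -[X in _ --> X]addr0; apply: cvgD cvg_harmonic; exact: cvg_cst.
  apply: cvg_trans; apply: near_eq_cvg.
  have /cvgr_lt/(_ (d - c)) : @harmonic R n @[n --> \oo] --> (0 : R).
    exact: cvg_harmonic.
  rewrite subr_gt0 => /(_ cd); apply: filterS => n hn.
  by rewrite /= kcc ?ltr_wpDl// -lerBrDl ltW.
have kco (c d : R) : 0 <= c -> c < d -> kappa `[c, d[%classic = (d - c)%:E.
  move=> c0 cd.
  have -> : kappa `[c, d[%classic = kappa `[c, d]%classic.
    rewrite -(@setUitv1 _ _ (BLeft c) d true) ?bnd_simp ?ltW//.
    rewrite measureU//; last first.
      by apply/seteqP; split => // x [] /= /[swap] ->;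
        rewrite in_itv/= ltxx andbF.
    rewrite [X in (_ + X)%E](_ : _ = 0%E) ?adde0//.
    by apply: kx; rewrite (le_trans c0)// ltW.
  rewrite -(@setU1itv _ _ (BRight d) c false) ?bnd_simp ?ltW//.
  rewrite measureU//; last first.
    by apply/seteqP; split => // x [] /= ->; rewrite in_itv/= ltxx.
  rewrite [X in (X + _)%E](_ : _ = 0%E) ?add0e; last exact: kx.
  exact: koc.
apply: lebesgue_measure_unique => /= _ [[c d]] _ <-.
rewrite lebesgue_measure_itv/= lte_fin.
case: ifPn => [cd|]; last first.
  by rewrite -leNgt => dc; rewrite set_itv_ge ?measure0// bnd_simp -leNgt.
rewrite -EFinB; have [c0|c0] := leP 0 c; first by rewrite koc.
have [d0|d0] := leP d 0.
  rewrite -kN// opp_preimage_itvbndbnd/= kco ?oppr_ge0 ?ltrN2//.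
  by rewrite opprK addrC.
rewrite (@itv_bndbnd_setU _ _ (BRight c) (BRight 0) (BRight d)) ?bnd_simp
  ?ltW//.
rewrite measureU//; last first.
  apply/seteqP; split => // x [] /=; rewrite !in_itv/= => /andP[_ x0] /andP[].
  by rewrite ltNge x0.
transitivity (kappa `]c, 0%R]%classic + kappa `]0%R, d]%classic)%E; last by [].
rewrite (koc 0 d)// subr0 -kN// opp_preimage_itvbndbnd/= oppr0 kco ?oppr_gt0//.
by rewrite -EFinD subr0 addrC.
Qed.

(** The measure w(x) dx is obtained as the area under the graph of w: restrict
    the plane Lebesgue measure to 0 <= s <= w(x) and project onto x. Its
    integrals are then computed by Tonelli's theorem. *)
Lemma weighted_lebesgue (R : realType) (w : R -> R) :
    measurable_fun [set: R] w -> (forall x, 0 <= w x) ->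
  exists nu : {measure set (measurableTypeR R) -> \bar R},
    forall f : measurableTypeR R -> \bar R, measurable_fun setT f ->
      (forall x, 0 <= f x)%E ->
    (\int[nu]_x f x = \int[lebesgue_measure]_x (f x * (w x)%:E))%E.
Proof.
move=> mw w0.
pose S : set (measurableTypeR R * measurableTypeR R) :=
  [set z | 0 <= z.2 <= w z.1].
have mS : measurable S.
  rewrite -[S]setTI.
  have m1 : measurable_fun [set: measurableTypeR R * measurableTypeR R]
      (fun z => 0 <= z.2).
    by apply: measurable_fun_ler => //; exact: measurable_snd.
  have m2 : measurable_fun [set: measurableTypeR R * measurableTypeR R]
      (fun z => z.2 <= w z.1).
    apply: measurable_fun_ler; first exact: measurable_snd.
    by apply: (measurableT_comp mw); exact: measurable_fst.
  by have := measurable_and m1 m2 measurableT (Y := [set true]); apply.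
pose mu2 := (@lebesgue_measure R \x @lebesgue_measure R)%E.
pose muS : {measure set (measurableTypeR R * measurableTypeR R)%type ->
  \bar R} := mrestr mu2 mS.
unshelve eexists (pushforward muS fst).
  exact: measurable_fst.
move=> f mf f0.
rewrite (ge0_integral_pushforward measurable_fst)//.
rewrite preimage_setT -(setUv S).
have mf1 : measurable_fun setT
    (f \o fst : measurableTypeR R * measurableTypeR R -> _).
  by apply: (measurableT_comp mf); exact: measurable_fst.
rewrite ge0_integral_setU//;
  [|exact: measurableC|exact: measurable_funTS| |]; last first.
  exact/disj_set2P/setICr.
  by move=> x _; exact: f0.
have -> : (\int[muS]_(x in ~` S) (f \o fst) x = 0)%E.
  rewrite (eq_measure_integral mzero) ?integral_measure_zero// => A mA AS.
  by rewrite /muS/= /mrestr (disjoints_subset _ _).2 ?measure0.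
rewrite adde0 (eq_measure_integral mu2); last first.
  by move=> A mA AS; rewrite /muS/= /mrestr setIidl.
rewrite integral_mkcond fubini_tonelli1; last 2 first.
  exact: ((measurable_restrictT (f \o fst) mS).1 (measurable_funTS mf1)).
  by move=> z; rewrite patchE; case: ifPn => // _; exact: f0.
apply: eq_integral => x _; rewrite /fubini_F/=.
transitivity (\int[lebesgue_measure]_y
    (f x * (\1_(`[0, w x]%classic : set R) y)%:E))%E.
  apply: eq_integral => y _; rewrite patchE indicE.
  have -> : ((x, y) \in S) = (y \in (`[0, w x]%classic : set R)).
    by apply/idP/idP => /set_mem yS; apply/mem_set; move: yS;
      rewrite /S/= in_itv.
  by case: ifPn; rewrite ?mule1 ?mule0.
rewrite ge0_integralZl//; last by apply/measurable_EFinP/measurable_indic.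
rewrite integral_indic// setIT [X in (_ * X)%E]lebesgue_measure_itv/=.
rewrite lte_fin sube0.
by have := w0 x; rewrite le_eqVlt => /predU1P[<-|->]//; rewrite ltxx.
Qed.

Lemma integral_powR_derive (R : realType) (t c d : R) : 0 < c -> c <= d ->
  (\int[lebesgue_measure]_(x in `[c, d]) (t * `|x| `^ (t - 1))%:E =
   (d `^ t - c `^ t)%:E)%E.
Proof.
move=> c0; rewrite le_eqVlt => /predU1P[<-|cd].
  by rewrite set_itv1 integral_set1 subrr.
transitivity (\int[lebesgue_measure]_(x in `[c, d]) (t * x `^ (t - 1))%:E)%E.
  apply: eq_integral => x; rewrite inE/= in_itv/= => /andP[cx _].
  by rewrite ger0_norm// (le_trans (ltW c0)).
have dpow (s x : R) : 0 < x -> derivable (fun y : R => y `^ s) x 1.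
  by move=> x0; apply: derivable_powR; rewrite in_itv/= x0.
have cpow (x : R) : 0 < x -> {for x, continuous (fun y : R => y `^ t)}.
  move=> x0; apply: differentiable_continuous; apply/derivable1_diffP.
  exact: dpow.
rewrite (@continuous_FTC2 _ _ (fun x => x `^ t)) ?EFinB//.
- apply: derivable_within_continuous => x; rewrite in_itv/= => /andP[cx _].
  by apply: derivableM => //; apply: dpow; exact: lt_le_trans cx.
- split.
  + by move=> x; rewrite in_itv/= => /andP[cx _]; apply/dpow/(lt_trans c0).
  + exact/cvg_at_right_filter/cpow.
  + exact/cvg_at_left_filter/cpow/(lt_trans c0).
- move=> x; rewrite in_itv/= => /andP[cx _].
  by rewrite powR_derive1// in_itv/= (lt_trans c0).
Qed.

Lemma measurable_spow_derive (R : realType) (t : R) :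
  measurable_fun [set: R] (fun x : R => t * `|x| `^ (t - 1)).
Proof.
apply: measurable_funM => //.
by apply: (measurableT_comp (measurable_powR _)); exact: normr_measurable.
Qed.

(** The image of the measure t |x|^(t-1) dx under x |-> x^t gives [c, d] the
    mass d - c for 0 < c <= d, is symmetric and does not charge 0: it is the
    Lebesgue measure. *)
Lemma ge0_integral_spow (R : realType) (t : R)
    (f : measurableTypeR R -> \bar R) :
    0 < t -> measurable_fun setT f -> (forall x, 0 <= f x)%E ->
  (\int[lebesgue_measure]_x f x =
   \int[lebesgue_measure]_x (f (spow x t) * (t * `|x| `^ (t - 1))%:E))%E.
Proof.
move=> t0 mf f0; have tn0 : t != 0 by rewrite gt_eqF.
pose w (x : R) := t * `|x| `^ (t - 1).
have mw : measurable_fun [set: R] w := measurable_spow_derive R t.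
have w0 x : 0 <= w x by rewrite mulr_ge0 ?powR_ge0 ?ltW.
pose psi : measurableTypeR R -> measurableTypeR R := fun x => spow x t.
have mpsi : measurable_fun setT psi by exact: measurable_spow.
have mpsiV (A : set R) : measurable A -> measurable (psi @^-1` A).
  by move=> mA; rewrite -[X in measurable X]setTI; exact: mpsi.
have [nu nuE] := weighted_lebesgue R w mw w0.
have nuA (A : set R) : measurable A ->
    nu A = (\int[lebesgue_measure]_(x in A) (w x)%:E)%E.
  move=> mA; rewrite -[A in LHS]setIT -integral_indic// nuE; first last.
  - by move=> x; rewrite lee_fin.
  - by apply/measurable_EFinP; exact: measurable_indic.
  rewrite [RHS]integral_mkcond; apply: eq_integral => x _.
  by rewrite patchE indicE; case: ifPn; rewrite ?mul1e ?mul0e.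
have [kappa kappaE] :
    exists kappa : {measure set (measurableTypeR R) -> \bar R},
    kappa = pushforward nu psi :> (set (measurableTypeR R) -> \bar R).
  by unshelve eexists (pushforward nu psi).
have nuN (A : set R) : measurable A -> nu (-%R @^-1` A) = nu A.
  move=> mA.
  have mN : measurable_fun setT (-%R : measurableTypeR R -> measurableTypeR R).
    by apply: continuous_measurable_fun; exact: opp_continuous.
  have mNA : measurable (-%R @^-1` A : set R).
    by rewrite -[X in measurable X]setTI; exact: mN.
  rewrite !nuA//.
  transitivity (\int[lebesgue_measure]_(x in -%R @^-1` A)
      (((fun x : measurableTypeR R => (w x)%:E) \o -%R) x))%E.
    by apply: eq_integral => x _ /=; rewrite /w normrN.
  rewrite -(ge0_integral_pushforward mN)//; last 2 first.
  - by apply/measurable_EFinP/measurable_funTS.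
  - by move=> x _; rewrite lee_fin.
  by apply: eq_measure_integral => B mB _; exact: lebesgue_measureN.
have lebE : forall A : set R, measurable A -> lebesgue_measure A = kappa A.
  apply: lebesgue_measure_unique_sym.
  - move=> A mA; rewrite kappaE /pushforward -[RHS]nuN//; last exact: mpsiV.
    congr (nu _); apply/seteqP.
    by split => x /=; rewrite /psi spowN.
  - rewrite kappaE /pushforward (_ : psi @^-1` _ = [set 0]).
      by rewrite nuA// integral_set1.
    by apply/seteqP; split => x /= /eqP; rewrite ?spow_eq0 => /eqP//;
      move=> ->; apply/eqP; rewrite spow_eq0.
  - move=> c d c0 cd; rewrite kappaE /pushforward.
    have spowVK (x : R) : spow (spow x t^-1) t = x.
      by have := spowK R t^-1; rewrite invrK; apply; rewrite invr_eq0.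
    have -> : psi @^-1` `[c, d] = `[spow c t^-1, spow d t^-1]%classic.
      rewrite -{1}(spowVK c) -{1}(spowVK d).
      by apply/seteqP; split => x /=; rewrite /psi !in_itv/= !ler_spow.
    have c0' : 0 < spow c t^-1 by rewrite -sgr_gt0 sgr_spow sgr_gt0.
    rewrite nuA// integral_powR_derive//; last first.
      by rewrite ler_spow ?invr_gt0.
    rewrite -!spow_ge0E ?spowVK// ltW// (lt_le_trans c0')//.
    by rewrite ler_spow ?invr_gt0.
transitivity (\int[kappa]_x f x)%E.
  by apply: eq_measure_integral => A mA _; exact: lebE.
transitivity (\int[pushforward nu psi]_x f x)%E.
  by apply: eq_measure_integral => A mA _; rewrite kappaE.
rewrite (ge0_integral_pushforward mpsi)// preimage_setT nuE//.
- exact: measurableT_comp.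
- by move=> x; exact: f0.
Qed.

(** * Change of variables in R^n *)

Lemma ge0_integral_lebesgue_tupleS (R : realType) n (f : Rn R n.+1 -> \bar R) :
    measurable_fun setT f -> (forall x, 0 <= f x)%E ->
  (\int[lebesgue_tuple n.+1]_x f x =
   \int[lebesgue_measure]_x \int[lebesgue_tuple n]_s f (consT (x, s)))%E.
Proof.
move=> mf f0.
rewrite [LHS](ge0_integral_pushforward (@measurable_consT R n))// preimage_setT.
rewrite fubini_tonelli1//; last by move=> x; exact: f0.
exact: (measurableT_comp mf (@measurable_consT R n)).
Qed.

Lemma measurable_spow_map (R : realType) (t : R) n :
  measurable_fun setT (@spow_map R n t : Rn R n -> Rn R n).
Proof.
apply/measurable_fun_tnthP => i.
rewrite (_ : _ \o _ = (fun u => spow u t) \o (fun x => tnth x i)); last first.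
  by apply/funext => x /=; rewrite tnth_map.
apply: measurableT_comp; first exact: measurable_spow.
exact: measurable_tnth.
Qed.

Lemma measurable_spow_jacobian (R : realType) (t : R) n :
  measurable_fun setT
    (fun x : Rn R n => \prod_(i < n) (t * `|tnth x i| `^ (t - 1))).
Proof.
apply: measurable_prod => i _.
apply: (measurableT_comp (measurable_spow_derive _ _)).
exact: measurable_tnth.
Qed.

Lemma ge0_integral_spow_map (R : realType) (t : R) n (f : Rn R n -> \bar R) :
    0 < t -> measurable_fun setT f -> (forall x, 0 <= f x)%E ->
  (\int[lebesgue_tuple n]_x f x =
   \int[lebesgue_tuple n]_x
     (f (spow_map t x) * (\prod_(i < n) (t * `|tnth x i| `^ (t - 1)))%:E))%E.
Proof.
move=> t0; elim: n f => [|n IH] f mf f0.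
  apply: eq_integral => x _; rewrite big_ord0 mule1; congr f.
  by rewrite (tuple0 x) [RHS]tuple0.
have w0 (x : R) : 0 <= t * `|x| `^ (t - 1) by rewrite mulr_ge0 ?powR_ge0 ?ltW.
have mfc : measurable_fun setT (f \o @consT R n).
  exact: (measurableT_comp mf (@measurable_consT R n)).
have mslice (x : R) : measurable_fun setT (fun s : Rn R n => f (consT (x, s))).
  exact: (measurableT_comp mfc (pair1_measurable x)).
rewrite ge0_integral_lebesgue_tupleS// [RHS]ge0_integral_lebesgue_tupleS//;
  last 2 first.
- apply: emeasurable_funM.
    exact: (measurableT_comp mf (measurable_spow_map _ _ _)).
  by apply/measurable_EFinP; exact: measurable_spow_jacobian.
- by move=> x; rewrite mule_ge0// lee_fin prodr_ge0.
rewrite (ge0_integral_spow _ t)//; last 2 first.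
- apply: (measurable_fun_fubini_tonelli_F (m2 := lebesgue_tuple n) _ mfc) => z.
  exact: f0.
- by move=> x; apply: integral_ge0 => s _; exact: f0.
apply: eq_integral => x _; rewrite IH//.
rewrite muleC -ge0_integralZl//; last 3 first.
- apply: emeasurable_funM.
    exact: (measurableT_comp (mslice _) (measurable_spow_map _ _ _)).
  by apply/measurable_EFinP; exact: measurable_spow_jacobian.
- by move=> s _; rewrite mule_ge0// lee_fin prodr_ge0.
- by rewrite lee_fin.
apply: eq_integral => s _.
rewrite muleCA; congr (_ * _)%E; first by congr f; exact: val_inj.
rewrite big_ord_recl -EFinM; congr (_ * _)%:E.
by apply: eq_bigr => i _; rewrite tnthS.
Qed.

Lemma ae_tnth_neq0 (R : realType) n :
  {ae lebesgue_tuple n, forall x : Rn R n, forall i, tnth x i != 0}.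
Proof.
elim: n => [|n [A [mA A0 NA]]]; first by apply: aeW => x [].
pose tl (x : Rn R n.+1) : Rn R n := [tuple of behead x].
have tlE x (s : Rn R n) : tl (consT (x, s)) = s by exact: val_inj.
have mhd : measurable (@thead n _ @^-1` [set 0] : set (Rn R n.+1)).
  rewrite -[X in measurable X]setTI.
  exact: (@measurable_tnth _ (measurableTypeR R) n.+1 ord0).
have mtl : measurable (tl @^-1` A).
  by rewrite -[X in measurable X]setTI; exact: measurable_behead.
suff : (lebesgue_tuple n.+1).-negligible
    (@thead n _ @^-1` [set 0] `|` tl @^-1` A).
  apply: negligibleS.
  move=> x /= /existsNP[i /negP/negPn/eqP].
  case: (unliftP ord0 i) => [j|] ->; last by left.
  move=> xj0; right; apply: NA => /= /(_ j)/eqP; apply; rewrite -xj0.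
  by rewrite !(tnth_nth 0) nth_behead.
apply: negligibleU.
- apply/negligibleP => //.
  transitivity ((lebesgue_measure \x lebesgue_tuple n)%E
      ([set (0 : measurableTypeR R)] `*` setT)).
    rewrite /= /tuple_step /pushforward; congr (_ _).
    by apply/seteqP; split => -[x s] /=; rewrite theadE//; case.
  rewrite product_measure1E// [X in (X * _)%E](_ : _ = 0%E) ?mul0e//.
  exact: lebesgue_measure_set1.
- apply/negligibleP => //.
  transitivity ((lebesgue_measure \x lebesgue_tuple n)%E
      ([set: measurableTypeR R] `*` A)).
    rewrite /= /tuple_step /pushforward; congr (_ _).
    apply/seteqP; split => -[x s] /=; first by rewrite tlE.
    by rewrite tlE => -[].
  by rewrite product_measure1E// [X in (_ * X)%E]A0 mule0.
Qed.

Lemma spow_mapK (R : realType) (t : R) n : t != 0 ->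
  cancel (@spow_map R n t) (spow_map t^-1).
Proof.
by move=> t0 x; apply: eq_from_tnth => i; rewrite !tnth_map (spowK _ _ t0).
Qed.

(** By the change of variables, the Jacobian integrates to 0 over the preimage
    of a null set, and it is positive off the coordinate hyperplanes. This
    transports to x what is known for almost every u = x^t. *)
Lemma negligible_spow_map (R : realType) (t : R) n (N : set (Rn R n)) : 0 < t ->
  (lebesgue_tuple n).-negligible N ->
  (lebesgue_tuple n).-negligible (spow_map t @^-1` N).
Proof.
move=> t0 [A [mA A0 NA]].
apply: (negligibleS (preimage_subset NA)).
pose J (x : Rn R n) := \prod_(i < n) (t * `|tnth x i| `^ (t - 1)).
have J0 x : 0 <= J x.
  by apply: prodr_ge0 => i _; rewrite mulr_ge0 ?powR_ge0 ?ltW.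
have mA1 : measurable_fun setT (fun x : Rn R n => (\1_A x : R)%:E).
  by apply/measurable_EFinP; exact: measurable_indic.
pose g (x : Rn R n) := ((\1_A (spow_map t x) : R)%:E * (J x)%:E)%E.
have mg : measurable_fun setT g.
  apply: emeasurable_funM.
    exact: (measurableT_comp mA1 (measurable_spow_map _ _ _)).
  by apply/measurable_EFinP; exact: measurable_spow_jacobian.
have : (\int[lebesgue_tuple n]_x `|g x| = 0)%E.
  rewrite -A0 -[A in RHS]setIT -integral_indic//.
  rewrite [RHS](ge0_integral_spow_map _ t)//.
    apply: eq_integral => x _; rewrite gee0_abs//.
    by rewrite /g mule_ge0// lee_fin.
move=> /ae_eq_integral_abs -/(_ measurableT mg) g0.
suff : {ae lebesgue_tuple n, forall x : Rn R n, ~ A (spow_map t x)}.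
  by apply: negligibleS => x Ax; apply.
move: g0 (ae_tnth_neq0 R n).
apply: filterS2 => x /= gx0 xn0 Ax; have := gx0 I; apply/eqP.
rewrite /g indicE mem_set// mul1e eqe gt_eqF// prodr_gt0// => i _.
by rewrite mulr_gt0// powR_gt0// normr_gt0.
Qed.

(** Stated for nonnegative functions so that it applies to the positive and
    negative parts of the correlation functions. *)
Lemma ge0_integral_spow_map_preimage (R : realType) (t : R) n
    (h h' : Rn R n -> \bar R) (A : set (Rn R n)) : 0 < t -> measurable A ->
    measurable_fun setT h -> measurable_fun setT h' ->
    (forall x, 0 <= h x)%E -> (forall x, 0 <= h' x)%E ->
    {ae lebesgue_tuple n, forall x,
      (h' (spow_map t x) * (\prod_(i < n) (t * `|tnth x i| `^ (t - 1)))%:E)%E =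
      h x} ->
  (\int[lebesgue_tuple n]_(x in spow_map t^-1 @^-1` A) h' x =
   \int[lebesgue_tuple n]_(x in A) h x)%E.
Proof.
move=> t0 mA mh mh' h0 h'0 hh'; have tn0 : t != 0 by rewrite gt_eqF.
have mB : measurable (spow_map t^-1 @^-1` A).
  by rewrite -[X in measurable X]setTI; exact: measurable_spow_map.
have w0 (x : R) : 0 <= t * `|x| `^ (t - 1) by rewrite mulr_ge0 ?powR_ge0 ?ltW.
have mh'B : measurable_fun setT (h' \_ (spow_map t^-1 @^-1` A)).
  exact: ((measurable_restrictT h' mB).1 (measurable_funTS mh')).
have h'B0 x : (0 <= (h' \_ (spow_map t^-1 @^-1` A)) x)%E.
  by rewrite patchE; case: ifPn.
rewrite integral_mkcond [RHS]integral_mkcond (ge0_integral_spow_map _ t)//.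
apply: ge0_ae_eq_integral => //.
- apply: emeasurable_funM.
    exact: (measurableT_comp mh'B (measurable_spow_map _ _ _)).
  by apply/measurable_EFinP; exact: measurable_spow_jacobian.
- exact: ((measurable_restrictT h mA).1 (measurable_funTS mh)).
- by move=> x _; rewrite mule_ge0// lee_fin prodr_ge0.
- by move=> x _; rewrite patchE; case: ifPn.
apply: filterS hh' => x hx _; rewrite !patchE.
have -> : (spow_map t x \in spow_map t^-1 @^-1` A) = (x \in A).
  by apply/idP/idP => /set_mem Ax; apply/mem_set; move: Ax;
    rewrite /preimage/= spow_mapK.
by case: ifPn => // _; rewrite mul0e.
Qed.

(** * Invariance of the bulk correlation functions *)

Theorem corollary5p6 (R : realType) (theta alpha : R)
    (theta_gt0 : 0 < theta) (alpha_gtN1 : -1 < alpha)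
    (n : nat) (n_gt0 : (0 < n)%N)
    (rho rho' : Rn R n -> measurableTypeR R)
    (rhoP : her_bulk_corr alpha theta rho)
    (rho'P : her_bulk_corr ((alpha + 1) / theta - 1) theta^-1 rho') :
  forall A : set (Rn R n), measurable A ->
    pushforward (density_measure rho') (spow_map theta^-1) A =
    density_measure rho A.
Proof.
move=> A mA; have t0 : theta != 0 by rewrite gt_eqF.
have [mrho rhoE] := rhoP; have [mrho' rho'E] := rho'P.
pose J (x : Rn R n) := \prod_(i < n) (theta * `|tnth x i| `^ (theta - 1)).
have J0 x : 0 <= J x.
  by apply: prodr_ge0 => i _; rewrite mulr_ge0 ?powR_ge0 ?ltW.
have rhoJ : {ae lebesgue_tuple n, forall x : Rn R n,
    (rho' (spow_map theta x) : R) * J x = rho x}.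
  have := negligible_spow_map R theta n _ theta_gt0 rho'E.
  have : {ae lebesgue_tuple n, forall x : Rn R n,
      rho x = her_det alpha theta x}.
    by apply: filterS rhoE => x [].
  have := ae_tnth_neq0 R n.
  apply: filterS3 => x x0 -> rho'x.
  rewrite -(her_det_dual _ _ _ _ _ t0 x0).
  by case: rho'x => _ ->.
rewrite /pushforward /density_measure integralE [RHS]integralE.
have mErho : measurable_fun setT (fun x => (rho x : R)%:E).
  exact/measurable_EFinP.
have mErho' : measurable_fun setT (fun x => (rho' x : R)%:E).
  exact/measurable_EFinP.
(* the Jacobian is nonnegative, so it commutes with taking positive and
   negative parts *)
have maxJ (r : R) x : (maxe r%:E 0 * (J x)%:E = maxe (r * J x)%:E 0)%E.
  by rewrite -!EFin_max -EFinM maxr_pMl// mul0r.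
congr (_ - _)%E; apply: ge0_integral_spow_map_preimage => //.
- exact: measurable_funepos.
- exact: measurable_funepos.
- by apply: filterS rhoJ => x rx; rewrite !funeposE -rx; exact: maxJ.
- exact: measurable_funeneg.
- exact: measurable_funeneg.
- apply: filterS rhoJ => x rx; rewrite !funenegE -rx -!EFinN -mulNr.
  exact: maxJ.
Qed.
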